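(* Let $C^\bullet=\{C^j,\delta\}$ be a finite dimensional real cochain complex with a graded commutative product $\cup$ and a positive definite inner product $\langle\,,\rangle$, and let $\nu\ge0$. Consider the flow on $C^1$ \[ \frac{\partial c}{\partial t}=\pi\left(T_\nu(c)\right). \] Then: (i) the harmonic elements $c\in C^1$, i.e. those satisfying $\delta c=\delta^*c=0$, are steady state solutions, i.e. $\pi(T_\nu(c))=0$; (ii) every co-closed solution $c(t)$ (i.e. with $\delta^*c(t)=0$) satisfies \[ \frac{\partial}{\partial t}\|c\|^2=-2\nu\|\delta c\|^2 ; \] (iii) any such flow (Navier-Stokes, $\nu>0$, or Euler, $\nu=0$) is defined for all time.
   Context: The product $\cup:C^j\times C^k\to C^{j+k}$ is bilinear and graded commutative, $a\cup b=(-1)^{jk}\,b\cup a$ for $a\in C^j$, $b\in C^k$; it is not assumed associative. The inner product is defined on $C^\bullet$ (on each $C^j$), $\|\cdot\|$ is its norm, and $\delta^*$ is the adjoint of $\delta$ with respect to it. For $c\in C^1$, $T_\nu(c)\in C^1$ is the element determined by \[ \langle T_\nu(c),b\rangle=\langle\delta c,c\cup b\rangle-\nu\langle\delta c,\delta b\rangle\quad\text{for all } b\in C^1, \] and $\pi$ is the orthogonal projection of $C^1$ onto the kernel of $\delta^*:C^1\to C^0$. The case $\nu>0$ is the finite model of Navier-Stokes flow and $\nu=0$ the finite model of Euler flow. *)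

(* Defs.v *)
From HB Require Import structures.
From mathcomp Require Import all_boot all_order all_algebra.
From mathcomp Require Import all_classical all_reals all_analysis.
From mathcomp Require Import ring.

Set Implicit Arguments.
Unset Strict Implicit.
Unset Printing Implicit Defensive.

Import Order.TTheory GRing.Theory Num.Theory.
Import numFieldNormedType.Exports.

Local Open Scope classical_set_scope.
Local Open Scope ring_scope.

#[short(type="normedVectType")]
HB.structure Definition NormedVector (R : numDomainType) :=
  {V of NormedModule R V & Vector R V}.

Section Euclidean.
Variable R : realType.
Implicit Types U V : normedVectType R.

(* The element x with <x, b> = phi b for all b. It exists and is unique when
   phi is linear, see rieszP and dot_inj. *)
Definition riesz V (ip : {dot V for idfun}) (phi : V -> R) : V :=
  xget 0 [set x | forall b, ip x b = phi b].

Definition adjoint U V (ipU : {dot U for idfun}) (ipV : {dot V for idfun})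
    (f : 'Hom(U, V)) : 'Hom(V, U) :=
  linfun (fun y => riesz ipU (fun x => ipV y (f x))).

Definition orthoproj V (ip : {dot V for idfun}) (U : {vspace V}) : 'End(V) :=
  daddv_pi U (orthov ip U).

Lemma dot_inj V (ip : {dot V for idfun}) x y :
  (forall b, ip x b = ip y b) -> x = y.
Proof.
move=> xy; apply/eqP; rewrite -subr_eq0; apply/negPn/negP => xy0.
have := @neq0_dnorm_gt0 _ _ _ ip _ xy0.
by rewrite linearBl /= xy subrr ltxx.
Qed.

Lemma dot_sym V (ip : {dot V for idfun}) x y : ip x y = ip y x.
Proof. by rewrite hermC /= expr0 mul1r. Qed.

Lemma riesz_sub V (ip : {dot V for idfun}) (U : {vspace V}) (phi : V -> R) :
  scalar phi -> exists2 x, x \in U & forall b, b \in U -> ip x b = phi b.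
Proof.
move=> phi_lin; pose e := vbasis U.
pose g x : 'rV[R]_(\dim U) := \row_i ip x e`_i.
have g_lin : linear g.
  by move=> a x y; apply/rowP => i; rewrite !mxE linearPl.
pose gL := GRing.isLinear.Build _ _ _ _ g g_lin.
pose G := linfun (HB.pack g gL : {linear V -> 'rV[R]_(\dim U)}).
have GE x : G x = g x by rewrite lfunE.
have ext (f h : V -> R) : scalar f -> scalar h ->
    (forall i : 'I_(\dim U), f e`_i = h e`_i) -> {in U, f =1 h}.
  move=> fl hl fh b bU.
  pose F : {scalar V} := HB.pack f (GRing.isLinear.Build _ _ _ _ f fl).
  pose H : {scalar V} := HB.pack h (GRing.isLinear.Build _ _ _ _ h hl).
  change (F b = H b); rewrite (coord_vbasis bU) !linear_sum.
  by apply: eq_bigr => i _; rewrite !linearZ /=; congr (_ * _); apply: fh.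
have sc x : scalar (ip x) by move=> a u v; exact: linearPr.
have kerG : (U :&: lker G = 0)%VS.
  apply/eqP; rewrite -subv0; apply/subvP => w.
  rewrite memv_cap memv_ker GE => /andP[wU /eqP/rowP gw].
  rewrite memv0; apply/negPn/negP => w0.
  have := @neq0_dnorm_gt0 _ _ _ ip _ w0.
  rewrite (ext (ip w) (fun=> 0)) ?ltxx// => [a u v|i]; first by rewrite mulr0 addr0.
  by have := gw i; rewrite !mxE.
have limG : (G @: U)%VS = fullv.
  apply/eqP; rewrite eqEdim subvf /= limg_dim_eq //.
  by rewrite dimvf /dim /= mul1n.
have /memv_imgP[x xU xE] : (\row_i phi e`_i) \in (G @: U)%VS by rewrite limG memvf.
exists x => //; apply: ext => // i.
by move: xE; rewrite GE => /rowP/(_ i); rewrite !mxE.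
Qed.

Lemma rieszP V (ip : {dot V for idfun}) (phi : V -> R) :
  scalar phi -> forall b, ip (riesz ip phi) b = phi b.
Proof.
move=> /(@riesz_sub _ ip fullv)[x _ xE].
have xP : [set x | forall b, ip x b = phi b] x by move=> b; rewrite xE ?memvf.
exact: (@xgetPex _ 0 _ (ex_intro _ x xP)).
Qed.

Lemma adjointP U V (ipU : {dot U for idfun}) (ipV : {dot V for idfun})
    (f : 'Hom(U, V)) x y : ipU (adjoint ipU ipV f y) x = ipV y (f x).
Proof.
pose g y := riesz ipU (fun x => ipV y (f x)).
have gE z b : ipU (g z) b = ipV z (f b).
  rewrite (@rieszP _ _ (fun x => ipV z (f x)))// => a u v.
  by rewrite linearP linearPr.
have g_lin : linear g.
  move=> a u v; apply: (@dot_inj _ ipU) => b.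
  by rewrite linearPl /= !gE linearPl.
pose G : {linear V -> U} := HB.pack g (GRing.isLinear.Build _ _ _ _ g g_lin).
by rewrite -[adjoint _ _ _]/(linfun G) lfunE gE.
Qed.

Lemma orthoproj_in V (ip : {dot V for idfun}) (U : {vspace V}) x :
  orthoproj ip U x \in U.
Proof. exact: memv_pi. Qed.

Lemma orthoprojP V (ip : {dot V for idfun}) (U : {vspace V}) x u :
  u \in U -> ip (orthoproj ip U x) u = ip x u.
Proof.
move=> uU.
have capU : (U :&: orthov ip U = 0)%VS.
  apply/eqP; rewrite -subv0; apply/subvP => w.
  rewrite memv_cap => /andP[wU /mem_orthovP/(_ w wU) w0].
  rewrite memv0; apply/negPn/negP => wn0.
  by have := @neq0_dnorm_gt0 _ _ _ ip _ wn0; rewrite w0 ltxx.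
have [|p pU pE] := @riesz_sub V ip U (ip x).
  by move=> a v w; exact: linearPr.
have xUo : x - p \in orthov ip U.
  by apply/mem_orthovP => v vU; rewrite linearBl /= pE // subrr.
have xU : x \in (U + orthov ip U)%VS.
  by rewrite -[x](subrK p) addrC memv_add.
rewrite -{2}(daddv_pi_add capU xU) linearDl /=.
have /mem_orthovP/(_ u uU) -> := memv_pi (orthov ip U) U x.
by rewrite addr0.
Qed.

End Euclidean.

(* Requiring the norm of each C^j to be the one induced by the inner product
   makes `| _ | and is_derive below refer to that inner product. The product
   need be neither associative nor compatible with the coboundary. *)
Record cochainAlgebra (R : realType) := CochainAlgebra {
  cochain :> nat -> normedVectType R;
  cobdry : forall j, 'Hom(cochain j, cochain j.+1);
  cobdryK : forall j x, cobdry j.+1 (cobdry j x) = 0;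
  cup : forall j k, {bilinear cochain j -> cochain k -> cochain (j + k)};
  cupC : forall j k (a : cochain j) (b : cochain k),
    cup j k a b =
    (-1) ^+ (j * k) *: ecast i (cochain i) (addnC k j) (cup k j b a);
  inner : forall j, {dot cochain j for idfun};
  innerE : forall j (x : cochain j), inner j x x = `|x| ^+ 2
}.

Section Flow.
Variables (R : realType) (C : cochainAlgebra R).

Definition cobdry_adj j : 'Hom(C j.+1, C j) :=
  adjoint (inner C j) (inner C j.+1) (cobdry C j).

Definition Tnu (nu : R) (c : C 1%N) : C 1%N :=
  riesz (inner C 1) (fun b =>
    inner C 2 (cobdry C 1 c) (cup C 1 1 c b)
    - nu * inner C 2 (cobdry C 1 c) (cobdry C 1 b)).

Definition coclosed_proj : 'End(C 1%N) :=
  orthoproj (inner C 1) (lker (cobdry_adj 0)).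

Lemma TnuP nu c b : inner C 1 (Tnu nu c) b =
    inner C 2 (cobdry C 1 c) (cup C 1 1 c b)
    - nu * inner C 2 (cobdry C 1 c) (cobdry C 1 b).
Proof.
apply: (@rieszP _ (C 1%N) (inner C 1) (fun b =>
    inner C 2 (cobdry C 1 c) (cup C 1 1 c b)
    - nu * inner C 2 (cobdry C 1 c) (cobdry C 1 b))) => a u v.
by rewrite !linearP /=; ring.
Qed.

(* The ODE on J is used only for open J, where the two-sided derivative is
   determined by the restriction of c to J. *)
Definition flow_solution (nu : R) (J : set R) (c : R -> C 1%N) :=
  forall t, J t -> is_derive t (1 : R) c (coclosed_proj (Tnu nu (c t))).

End Flow.

(* Main.v *)
(* Pairing the flow with a co-closed u gives <d c, c cup u> - nu <d c, d u>, and
   u cup u = 0 by graded commutativity; (i) and (ii) follow at once.  For (iii),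
   the velocity is co-closed, so c - h stays co-closed for the constant
   h = c0 - pi c0, which is orthogonal to the co-closed elements and hence
   closed.  With u = c - h the energy balance reads
   d|u|^2/dt = 2 <d u, h cup u> - 2 nu |d u|^2, so |u|^2 grows at most
   exponentially, forwards and backwards in time.  The field is quadratic, hence
   Lipschitz on balls; cutting it off outside a large ball gives a bounded
   globally Lipschitz field whose solution is global by Picard iteration, and
   the energy bound shows that on a given time interval the cut-off is never
   felt. *)

Require Import Defs.
From mathcomp Require Import all_boot all_order all_algebra.
From mathcomp Require Import all_classical all_reals all_analysis.
From mathcomp Require Import ring lra.

Import Order.TTheory GRing.Theory Num.Theory.
Import numFieldNormedType.Exports.

Local Open Scope classical_set_scope.
Local Open Scope ring_scope.

(** * Linear maps and curves in Euclidean spaces *)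

Section InnerProduct.
Context {R : realType} {V : normedVectType R} {ip : {dot V for idfun}}.
Hypothesis ipE : forall x, ip x x = `|x| ^+ 2.

(** Cauchy-Schwarz: the squared norm of |y|^2 x - <x,y> y is |y|^2 (|x|^2 |y|^2 - <x,y>^2). *)
Lemma dot_le_norm x y : `|ip x y| <= `|x| * `|y|.
Proof using ipE.
have [->|y0] := eqVneq y 0.
  by rewrite linear0r !normr0 mulr0.
have ny : 0 < `|y| by rewrite normr_gt0.
have : 0 <= ip (`|y| ^+ 2 *: x - ip x y *: y) (`|y| ^+ 2 *: x - ip x y *: y).
  by rewrite ipE sqr_ge0.
rewrite linearBl/= !linearBr/= !linearZl/= !linearZr/= !ipE (dot_sym ip y x).
move=> h; rewrite -(ler_pXn2r (ltn0Sn 1)) ?nnegrE ?mulr_ge0//.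
rewrite real_normK ?num_real// exprMn.
rewrite -subr_ge0 -(@pmulr_rge0 _ (`|y| ^+ 2)) ?exprn_gt0//.
by rewrite (le_trans h)// le_eqVlt; apply/orP; left; apply/eqP;
  rewrite /GRing.scale/=; ring.
Qed.

Lemma sum_vbasis x : x = \sum_i coord (vbasis {:V}) i x *: (vbasis {:V})`_i.
Proof. by rewrite -coord_vbasis ?memvf. Qed.

(** A coordinate functional is the pairing with its Riesz vector, so Cauchy-Schwarz bounds it by the
    norm of that vector. *)
Lemma coord_bounded : exists r : 'I_(\dim {:V}) -> R, forall i,
  0 <= r i /\ forall x, `|coord (vbasis {:V}) i x| <= r i * `|x|.
Proof using ipE.
exists (fun i => `|riesz ip (coord (vbasis {:V}) i)|) => i; split=> // x.
have cl : scalar (coord (vbasis {:V}) i) by move=> a u v; rewrite linearP.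
by rewrite -(@rieszP _ _ ip _ cl x) dot_le_norm.
Qed.

Lemma linear_bounded {W : normedModType R} (f : {linear V -> W}) :
  exists2 M : R, 0 <= M & forall x, `|f x| <= M * `|x|.
Proof using ipE.
have [r rP] := coord_bounded.
exists (\sum_i r i * `|f (vbasis {:V})`_i|) => [|x].
  by apply: sumr_ge0 => i _; rewrite mulr_ge0//; have [] := rP i.
rewrite {1}(sum_vbasis x) linear_sum (le_trans (ler_norm_sum _ _ _))//.
rewrite mulr_suml ler_sum// => i _.
by rewrite linearZ normrZ mulrAC ler_wpM2r//; have [_] := rP i.
Qed.

Lemma vect_linear_continuous {W : normedModType R} (f : {linear V -> W}) :
  continuous f.
Proof using ipE.
have [M M0 fM] := linear_bounded f.
apply/bounded_linear_continuous/linear_boundedP; near=> N => x.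
by rewrite (le_trans (fM x))// ler_wpM2r.
Unshelve. all: end_near. Qed.

(** Difference quotients commute with a linear map, and continuity of [f] lets the limit pass
    through. *)
Lemma is_derive_linear {W : normedModType R} (f : {linear V -> W}) c t dc :
  is_derive t (1 : R) c dc -> is_derive t (1 : R) (fun s => f (c s)) (f dc).
Proof using ipE.
move=> [cd <-]; have fc := vect_linear_continuous f.
suff h : (fun h => h^-1 *: (((fun s => f (c s)) \o shift t) (h *: (1 : R)) - f (c t)))
    @ 0^' --> f ('D_1 c t).
  by apply: DeriveDef; [apply/cvg_ex; exists (f ('D_1 c t))|exact: cvg_lim h].
have -> : (fun h => h^-1 *: (((fun s => f (c s)) \o shift t) (h *: (1 : R)) - f (c t)))
   = f \o (fun h => h^-1 *: ((c \o shift t) (h *: (1 : R)) - c t)).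
  by apply/funext => h; rewrite /= -linearB -linearZ.
by apply: continuous_cvg; [exact: fc|exact: cd].
Qed.

(** In a basis the pairing is a finite sum of products of two linear functionals, one of each curve,
    and the real product rule applies to each. *)
Lemma is_derive_dot x y t dx dy :
  is_derive t (1 : R) x dx -> is_derive t (1 : R) y dy ->
  is_derive t (1 : R) (fun s => ip (x s) (y s)) (ip dx (y t) + ip (x t) dy).
Proof using ipE.
move=> xd yd.
pose g i : {linear V -> R} := ip (vbasis {:V})`_i.
have ipg u v : ip u v = \sum_i coord (vbasis {:V}) i u * g i v.
  by rewrite {1}(sum_vbasis u) linear_sumlz; apply: eq_bigr => i _; rewrite linearZl.
have -> : (fun s => ip (x s) (y s)) =
    \sum_i (fun s => coord (vbasis {:V}) i (x s) : R) * (fun s => g i (y s)).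
  by apply/funext => s; rewrite ipg fct_sumE.
apply: is_derive_eq.
  apply: is_derive_sum => i; apply: is_deriveM.
    exact: (is_derive_linear (coord (vbasis {:V}) i) _ _ _ xd).
  exact: (is_derive_linear (g i) _ _ _ yd).
rewrite !ipg -big_split/=; apply: eq_bigr => i _.
by rewrite /GRing.scale/=; ring.
Qed.

Lemma is_derive_sqr_norm x t dx : is_derive t (1 : R) x dx ->
  is_derive t (1 : R) (fun s => `|x s| ^+ 2) (2 * ip dx (x t)).
Proof using ipE.
move=> xd; under eq_fun do rewrite -ipE.
apply: is_derive_eq; first exact: (is_derive_dot _ _ _ _ _ xd xd).
by rewrite (dot_sym ip (x t)); ring.
Qed.

End InnerProduct.

(** A basis of [U] splits [f] into finitely many linear maps of the second argument. *)
Lemma bilinear_bounded {R : realType} {U V : normedVectType R} {W : normedModType R}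
    {ipU : {dot U for idfun}} {ipV : {dot V for idfun}} :
  (forall x, ipU x x = `|x| ^+ 2) -> (forall x, ipV x x = `|x| ^+ 2) ->
  forall f : {bilinear U -> V -> W},
  exists2 K : R, 0 <= K & forall x y, `|f x y| <= K * `|x| * `|y|.
Proof.
move=> ipUE ipVE f; have [r rP] := coord_bounded ipUE.
have /choice[M MP] : forall i : 'I_(\dim {:U}), exists M : R,
    0 <= M /\ forall y, `|f (vbasis {:U})`_i y| <= M * `|y|.
  by move=> i; have [M M0 MP] := linear_bounded ipVE (f (vbasis {:U})`_i); exists M.
exists (\sum_i r i * M i) => [|x y].
  by apply: sumr_ge0 => i _; apply: mulr_ge0; [have [] := rP i|have [] := MP i].
rewrite {1}(sum_vbasis x) linear_sumlz (le_trans (ler_norm_sum _ _ _))//.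
rewrite !mulr_suml ler_sum// => i _.
have [r0 ri] := rP i; have [M0 Mi] := MP i.
have -> : r i * M i * `|x| * `|y| = (r i * `|x|) * (M i * `|y|) by ring.
by rewrite linearZl normrZ ler_pM.
Qed.

(** * Growth estimates *)

Section RealFunctions.
Context {R : realType}.
Implicit Types (f df : R -> R) (a b t : R).

Lemma is_derive_continuous {W : normedModType R} (x : R -> W) t dx :
  is_derive t (1 : R) x dx -> {for t, continuous x}.
Proof.
by move=> [xd _]; apply: differentiable_continuous; exact/derivable1_diffP.
Qed.

Lemma is_derive_within_continuous {W : normedModType R} (x dx : R -> W) a b :
  (forall s, a <= s <= b -> is_derive s (1 : R) x (dx s)) ->
  {within `[a, b], continuous x}.
Proof.
move=> xd; apply: derivable_within_continuous => s.
by rewrite in_itv/= => /xd[].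
Qed.

Lemma le_of_derive_ge0 f df a b : a <= b ->
  (forall s, a <= s <= b -> is_derive s (1 : R) f (df s)) ->
  (forall s, a <= s <= b -> 0 <= df s) -> f a <= f b.
Proof.
move=> ab fd df0.
have [|c] := @MVT_segment R f df a b ab _ (is_derive_within_continuous _ _ _ _ fd).
  by move=> s; rewrite in_itv/= => /andP[/ltW ? /ltW ?]; apply: fd; apply/andP.
rewrite in_itv/= => /df0 c0 fE.
by rewrite -subr_ge0 fE mulr_ge0// subr_ge0.
Qed.

Lemma is_derive_expRM (k t : R) :
  is_derive t (1 : R) (fun s => expR (k * s)) (k * expR (k * t)).
Proof.
have kd : is_derive t (1 : R) (fun s : R => k * s) (k *: 1).
  exact: (is_deriveZ (f := id)).
have := is_derive1_comp (is_derive_expR _) kd.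
by rewrite /GRing.scale/= mulr1 mulrC.
Qed.

Lemma gronwall {E dE : R -> R} {K a b : R} : a <= b ->
  (forall s, a <= s <= b -> is_derive s (1 : R) E (dE s)) ->
  (forall s, a <= s <= b -> `|dE s| <= K * E s) ->
  E b <= E a * expR (K * (b - a)) /\ E a <= E b * expR (K * (b - a)).
Proof.
move=> ab Ed EK.
have D k s : a <= s <= b ->
    is_derive s (1 : R) (E * (fun s => expR (k * s))) ((dE s + k * E s) * expR (k * s)).
  move=> sab; apply: (is_derive_eq (is_deriveM (Ed s sab) (is_derive_expRM k s))).
  by rewrite /GRing.scale/=; ring.
split.
- have h : - (E a * expR (- K * a)) <= - (E b * expR (- K * b)).
    apply: (le_of_derive_ge0 (- (E * (fun s => expR (- K * s)))) _ _ _ ab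
      (fun s sab => is_deriveN (D (- K) s sab))) => s sab.
    rewrite oppr_ge0 mulr_le0_ge0 ?expR_ge0// mulNr subr_le0.
    by rewrite (le_trans (ler_norm _))// EK.
  have -> : K * (b - a) = - K * a + K * b by ring.
  rewrite expRD mulrA -ler_pdivrMr ?expR_gt0// -expRN.
  by rewrite -mulNr -lerN2.
- have h : E a * expR (K * a) <= E b * expR (K * b).
    apply: (le_of_derive_ge0 (E * (fun s => expR (K * s))) _ _ _ ab (D K)) => s sab.
    rewrite mulr_ge0 ?expR_ge0// addrC -lerBlDr sub0r.
    by rewrite (le_trans _ (EK _ sab))// -normrN ler_norm.
  have -> : K * (b - a) = K * b + - (K * a) by ring.
  by rewrite expRD mulrA expRN ler_pdivlMr ?expR_gt0.
Qed.

End RealFunctions.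

Section Curves.
Context {R : realType} {V : normedVectType R} {ip : {dot V for idfun}}.
Hypothesis ipE : forall x, ip x x = `|x| ^+ 2.
Implicit Types (x y D : R -> V).

(** Pairing with v = D b - D a reduces the claim to a real function: |v| g - <v, D> is nondecreasing
    by Cauchy-Schwarz, and its end values give |v|^2 <= |v| (g b - g a). *)
Lemma mean_value_le {D dD : R -> V} {g dg : R -> R} {a b : R} : a <= b ->
  (forall s, a <= s <= b -> is_derive s (1 : R) D (dD s)) ->
  (forall s, a <= s <= b -> is_derive s (1 : R) g (dg s)) ->
  (forall s, a <= s <= b -> `|dD s| <= dg s) ->
  `|D b - D a| <= g b - g a.
Proof using ipE.
move=> ab Dd gd Dg; set v := D b - D a.
have [->|v0] := eqVneq v 0.
  rewrite normr0 subr_ge0; apply: (le_of_derive_ge0 _ _ _ _ ab gd) => s /Dg.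
  exact: le_trans.
have nv : 0 < `|v| by rewrite normr_gt0.
rewrite -(ler_pM2l nv) -expr2 -ipE {2}/v linearBr/= mulrBr -subr_ge0.
have fd s : a <= s <= b -> is_derive s (1 : R)
    (`|v| \*: g - (fun s => ip v (D s))) (`|v| *: dg s - ip v (dD s)).
  move=> sab; have ? := gd _ sab; have ? := Dd _ sab.
  by apply: is_deriveB; apply: (is_derive_linear ipE (ip v)).
have := le_of_derive_ge0 _ _ _ _ ab fd.
rewrite -subr_ge0 !fctE /GRing.scale/= => h; apply: le_trans (h _) _ => [s sab|].
  rewrite subr_ge0 (le_trans (ler_norm _))// (le_trans (dot_le_norm ipE _ _))//.
  by rewrite ler_wpM2l// Dg.
by rewrite le_eqVlt; apply/orP; left; apply/eqP; rewrite /GRing.scale/=; ring.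
Qed.

Lemma mean_value_abs_le {D dD : R -> V} {g dg : R -> R} (t0 t : R) :
  (forall s, is_derive s (1 : R) D (dD s)) ->
  (forall s, is_derive s (1 : R) g (dg s)) ->
  (forall s, `|dD s| <= dg s) ->
  `|D t - D t0| <= `|g t - g t0|.
Proof using ipE.
move=> Dd gd Dg; have [tt|/ltW tt] := leP t0 t.
  rewrite (le_trans _ (ler_norm _))//.
  exact: (mean_value_le tt (fun s _ => Dd s) (fun s _ => gd s) (fun s _ => Dg s)).
rewrite distrC (distrC (g t)) (le_trans _ (ler_norm _))//.
exact: (mean_value_le tt (fun s _ => Dd s) (fun s _ => gd s) (fun s _ => Dg s)).
Qed.

(** |D|^2 satisfies the Gronwall inequality with constant 2 L, so its zero at [t0] propagates to
    both sides. *)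
Lemma curve_eq0 {D dD : R -> V} {L a b t0 : R} : a <= t0 <= b ->
  (forall s, a <= s <= b -> is_derive s (1 : R) D (dD s)) ->
  (forall s, a <= s <= b -> `|dD s| <= L * `|D s|) ->
  D t0 = 0 -> forall t, a <= t <= b -> D t = 0.
Proof using ipE.
move=> /andP[at0 t0b] Dd DL Dt0 t /andP[at_ tb].
suff : `|D t| ^+ 2 <= 0.
  by rewrite real_exprn_even_le0 ?num_real//= normr_eq0 => /eqP.
have Ed s : a <= s <= b ->
    is_derive s (1 : R) (fun s => `|D s| ^+ 2) (2 * ip (dD s) (D s)).
  by move=> /Dd; exact: is_derive_sqr_norm.
have EK s : a <= s <= b -> `|2 * ip (dD s) (D s)| <= (2 * L) * `|D s| ^+ 2.
  move=> sab; rewrite normrM ger0_norm// -mulrA ler_wpM2l//.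
  by rewrite (le_trans (dot_le_norm ipE _ _))// expr2 mulrA ler_wpM2r// DL.
have [tt|/ltW tt] := leP t0 t.
- have sub s : t0 <= s <= t -> a <= s <= b by lra.
  have [+ _] := gronwall tt (fun s h => Ed s (sub s h)) (fun s h => EK s (sub s h)).
  by rewrite Dt0 normr0 expr0n mul0r.
- have sub s : t <= s <= t0 -> a <= s <= b by lra.
  have [_] := gronwall tt (fun s h => Ed s (sub s h)) (fun s h => EK s (sub s h)).
  by rewrite Dt0 normr0 expr0n mul0r.
Qed.

End Curves.

(** The value at t is read off [x (N t)], where [N t] exceeds |t - t0| strictly. Near t the glued
    curve coincides with this single curve, so the derivative carries over. *)
Lemma glue_curves {R : realType} {V : normedModType R} (f : R -> V -> V) (t0 : R)
    (x : nat -> R -> V) :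
  (forall n t, `|t - t0| < n%:R -> is_derive t (1 : R) (x n) (f t (x n t))) ->
  (forall n m t, (n <= m)%N -> `|t - t0| < n%:R -> x n t = x m t) ->
  exists2 y : R -> V, y t0 = x 1%N t0 &
    forall t, is_derive t (1 : R) y (f t (y t)).
Proof.
move=> xd xx; pose N t := (Num.trunc `|t - t0|).+1.
have tN t : `|t - t0| < (N t)%:R by rewrite /N truncnS_gt.
pose y t := x (N t) t.
have yx n t : `|t - t0| < n%:R -> y t = x n t.
  move=> tn; rewrite /y; have [/xx|/ltnW/xx] := leqP (N t) n; first exact.
  by move/(_ t tn).
exists y => [|t]; first by rewrite (yx 1%N)// subrr normr0.
rewrite (yx _ _ (tN t)); apply: near_eq_is_derive (xd _ _ (tN t)).
have : \forall s \near t, `|s - t0| < (N t)%:R.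
  have c : {for t, continuous (fun s : R => `|s - t0|)}.
    by apply: cvg_norm; apply: cvgB; [exact: cvg_id|exact: cvg_cst].
  exact: (cvgr_lt _ c _ (tN t)).
by apply: filterS => s /yx ->.
Qed.

(** * Primitives and limits *)

(** The integral from [a] is a primitive only to the right of [a]; a primitive on the whole line is
    glued later from base points tending to minus infinity. *)
Lemma real_primitive {R : realType} {f : R -> R} (a : R) : continuous f ->
  exists P : R -> R, forall t, a < t -> is_derive t (1 : R) P (f t).
Proof.
move=> cf.
exists (fun x => \int[@lebesgue_measure R]_(t in [set` `[a, x]]) f t)%R => t at_.
have tt1 : t < t + 1 by rewrite ltrDl.
have fi : (@lebesgue_measure R).-integrable `[a, t + 1] (EFin \o f).
  apply: continuous_compact_integrable; first exact: segment_compact.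
  exact: continuous_subspaceT.
have [Pd PE] := continuous_FTC1_closed tt1 fi at_ (cf t).
by apply: DeriveDef => //; rewrite -derive1E PE.
Qed.

Lemma is_derive_scalel {R : realType} {V : normedModType R} (v : V)
    (g : R -> R) (t dg : R) :
  is_derive t (1 : R) g dg -> is_derive t (1 : R) (fun s => g s *: v) (dg *: v).
Proof.
move=> [gd <-].
have h : (fun h => h^-1 *: (((fun s => g s *: v) \o shift t) (h *: (1 : R)) - g t *: v))
    @ 0^' --> 'D_1 g t *: v.
  have -> : (fun h => h^-1 *: (((fun s => g s *: v) \o shift t) (h *: (1 : R)) - g t *: v))
     = (fun h => (h^-1 *: ((g \o shift t) (h *: (1 : R)) - g t)) *: v).
    by apply/funext => h; rewrite /= -scalerBl scalerA.
  by apply: cvgZ; [exact: gd|exact: cvg_cst].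
by apply: DeriveDef; [apply/cvg_ex; exists ('D_1 g t *: v)|exact: cvg_lim h].
Qed.

Section Primitive.
Context {R : realType} {V : normedVectType R} {ip : {dot V for idfun}}.
Hypothesis ipE : forall x, ip x x = `|x| ^+ 2.

Lemma curve_primitive {f : R -> V} (t0 : R) (c0 : V) : continuous f ->
  exists2 P : R -> V, P t0 = c0 & forall t, is_derive t (1 : R) P (f t).
Proof using ipE.
move=> cf.
pose fi i t : R := coord (vbasis {:V}) i (f t).
have cfi i : continuous (fi i).
  move=> t; apply: (continuous_comp (g := coord (vbasis {:V}) i)); first exact: cf.
  exact: (vect_linear_continuous ipE (coord (vbasis {:V}) i)).
have /choice[G GP] : forall p : nat * 'I_(\dim {:V}), exists P : R -> R,
    forall t, t0 - p.1%:R < t -> is_derive t (1 : R) P (fi p.2 t).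
  by move=> [n i]; exact: real_primitive (cfi i).
(* Coordinatewise integrals based at t0 - n, shifted to take the value [c0] at [t0], so that
   different n agree wherever both are primitives. *)
pose x n t := c0 + \sum_i (G (n, i) t - G (n, i) t0) *: (vbasis {:V})`_i.
have xd n t : `|t - t0| < n%:R -> is_derive t (1 : R) (x n) (f t).
  rewrite ltr_distl => /andP[tn _].
  have -> : x n = cst c0 +
      \sum_i (fun s => (G (n, i) - cst (G (n, i) t0)) s *: (vbasis {:V})`_i).
    by apply/funext => s; rewrite /x !fctE fct_sumE.
  have h (i : 'I_(\dim {:V})) := is_derive_scalel (vbasis {:V})`_i _ _ _
    (is_deriveB (GP (n, i) t tn) (is_derive_cst (G (n, i) t0) t (1 : R))).
  apply: (is_derive_eq (is_deriveD (is_derive_cst c0 t (1 : R)) (is_derive_sum h))).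
  rewrite add0r [RHS]sum_vbasis; apply: eq_bigr => i _.
  by rewrite subr0.
have x0 n : x n t0 = c0.
  by rewrite /x big1 ?addr0// => i _; rewrite subrr scale0r.
have xx n m t : (n <= m)%N -> `|t - t0| < n%:R -> x n t = x m t.
  move=> nm tn; apply/eqP; rewrite -subr_eq0; apply/eqP.
  apply: (@curve_eq0 _ _ _ ipE (x n - x m) (fun=> 0) 0
      (t0 - `|t - t0|) (t0 + `|t - t0|) t0).
  - by have := normr_ge0 (t - t0); lra.
  - move=> s sb; rewrite -(subrr (f s)).
    have sn : `|s - t0| < n%:R by apply: le_lt_trans tn; rewrite ler_distl.
    by apply: is_deriveB; apply: xd => //; rewrite (lt_le_trans sn)// ler_nat.
  - by move=> s _; rewrite normr0 mul0r.
  - by rewrite !fctE !x0 subrr.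
  - by rewrite -ler_distl.
have [y yt0 yd] := glue_curves (fun t _ => f t) t0 x xd xx.
by exists y; rewrite ?yt0.
Qed.

(** Convergence is checked on coordinates, whose increments are dominated by a geometric series; the
    explicit rate is what the Picard iteration uses. *)
Lemma geometric_cvg {x : nat -> V} {C : R} :
  (forall n, `|x n.+1 - x n| <= C / 2 ^+ n) ->
  exists l, forall n, `|x n - l| <= 2 * C / 2 ^+ n.
Proof using ipE.
move=> xC.
have C0 : 0 <= C by have := le_trans (normr_ge0 _) (xC 0%N); rewrite expr0 divr1.
have half k : (1 / 2 : R) ^+ k = (2 ^+ k)^-1 by rewrite div1r exprVn.
(* Keeping the subtracted tail makes the induction on k close exactly; dropping it at the end leaves
   a bound uniform in k. *)
have step n k : `|x n - x (n + k)%N| <= 2 * C / 2 ^+ n - 2 * C / 2 ^+ (n + k).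
  elim: k => [|k IH]; first by rewrite addn0 !subrr normr0.
  rewrite addnS (le_trans (ler_distD (x (n + k)%N) _ _))//.
  have h := xC (n + k)%N; rewrite distrC in h; rewrite (le_trans (lerD IH h))//.
  rewrite le_eqVlt; apply/orP; left; apply/eqP.
  by rewrite exprS invfM; set a := (2 ^+ n)^-1; set b := (2 ^+ (n + k))^-1; field.
have [r rP] := coord_bounded ipE.
have cvi i : cvg ((fun n => coord (vbasis {:V}) i (x n) : R) @ \oo).
  pose u k : R := coord (vbasis {:V}) i (x k.+1) - coord (vbasis {:V}) i (x k).
  have -> : (fun n => coord (vbasis {:V}) i (x n) : R) =
     (fun n => coord (vbasis {:V}) i (x 0%N) + series u n).
    by apply/funext => n; rewrite /series/= telescope_sumr// addrC subrK.
  apply: is_cvgD; first exact: is_cvg_cst.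
  apply: normed_cvg; apply: (@series_le_cvg _ _ (geometric (r i * C) (1 / 2))).
  - by move=> k; exact: normr_ge0.
  - by move=> k; rewrite /geometric/= mulr_ge0// ?mulr_ge0 ?exprn_ge0//; have [] := rP i.
  - move=> k; rewrite /geometric/= half -mulrA /u -linearB.
    by have [r0 ri] := rP i; rewrite (le_trans (ri _))// ler_wpM2l.
  - by apply: is_cvg_geometric_series; rewrite ger0_norm//; lra.
pose l := \sum_i lim ((fun n => coord (vbasis {:V}) i (x n) : R) @ \oo) *: (vbasis {:V})`_i.
have xl : x n @[n --> \oo] --> l.
  have -> : x = (fun n => \sum_i coord (vbasis {:V}) i (x n) *: (vbasis {:V})`_i).
    by apply/funext => n; exact: sum_vbasis.
  apply: cvg_big => [|i _]; first exact: add_continuous.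
  apply: cvgZ; [exact: cvi|exact: cvg_cst].
exists l => n; apply/ler_addgt0Pr => e e0.
have /cvgrPdist_lt/(_ e e0)[N _ NP] := xl.
have := NP (n + N)%N; rewrite /= leq_addl => /(_ isT) h.
rewrite (le_trans (ler_distD (x (n + N)%N) _ _))// lerD//; last by rewrite distrC ltW.
rewrite (le_trans (step _ _))// gerBl// divr_ge0 ?exprn_ge0// mulr_ge0//.
Qed.

End Primitive.

(** * Picard iteration *)

Lemma lipschitz_continuous {R : realType} {U W : normedModType R} {F : U -> W}
    {L : R} :
  (forall x y, `|F x - F y| <= L * `|x - y|) -> continuous F.
Proof.
move=> FL x; apply/cvgrPdist_lt => e e0.
have L1 : 0 < `|L| + 1 by rewrite ltr_wpDl.
near=> y; rewrite (le_lt_trans (FL _ _))//.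
rewrite (@le_lt_trans _ _ ((`|L| + 1) * `|x - y|))//.
  by rewrite ler_wpM2r// (le_trans (ler_norm _))// lerDl.
rewrite mulrC -ltr_pdivlMr//.
near: y; apply: cvgr_dist_lt => //; exact: divr_gt0.
Unshelve. all: end_near. Qed.

Lemma le_of_le_geometric {R : realType} {a C : R} :
  (forall n, a <= C / 2 ^+ n) -> a <= 0.
Proof.
move=> aC; rewrite leNgt; apply/negP => a0.
have C0 : 0 < C by have := lt_le_trans a0 (aC 0%N); rewrite expr0 divr1.
have [n nC] : exists n : nat, C / a < n%:R
  by exists (Num.trunc (C / a)).+1; rewrite truncnS_gt.
have := aC n; rewrite ler_pdivlMr ?exprn_gt0// leNgt => /negP; apply.
rewrite -ltr_pdivrMl// mulrC (lt_le_trans nC)//.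
by rewrite -natrX ler_nat ltnW// ltn_expl.
Qed.

(* Up to the factor 2 L, the weight dominates its own primitive from t0 on both
   sides of t0, so that each Picard step halves the weighted distance. *)
Section ExpWeight.
Context {R : realType}.
Variables L t0 : R.

Definition exp_weight t : R := expR (2 * L * (t - t0)) + expR (- (2 * L * (t - t0))).

Definition exp_weight_prim t : R := expR (2 * L * (t - t0)) - expR (- (2 * L * (t - t0))).

Lemma exp_weight_prim_le t : `|exp_weight_prim t| <= exp_weight t.
Proof. by rewrite (le_trans (ler_normB _ _))// !ger0_norm ?expR_ge0. Qed.

Lemma exp_weight_prim0 : exp_weight_prim t0 = 0.
Proof. by rewrite /exp_weight_prim subrr mulr0 oppr0 subrr. Qed.

Lemma is_derive_exp_weight_prim t :
  is_derive t (1 : R) exp_weight_prim (2 * L * exp_weight t).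
Proof.
have -> : exp_weight_prim = (expR (- (2 * L * t0)) \*: fun s => expR (2 * L * s))
    - (expR (2 * L * t0) \*: fun s => expR (- (2 * L) * s)).
  apply/funext => s; rewrite /exp_weight_prim.
  have -> : 2 * L * (s - t0) = - (2 * L * t0) + 2 * L * s by ring.
  have -> : - (- (2 * L * t0) + 2 * L * s) = 2 * L * t0 + - (2 * L) * s by ring.
  by rewrite !expRD.
have h k r : is_derive t (1 : R) (r \*: fun s => expR (k * s)) (r *: (k * expR (k * t))).
  by apply: is_deriveZ; exact: is_derive_expRM.
apply: (is_derive_eq (is_deriveB (h _ _) (h _ _))).
rewrite /exp_weight.
have -> : 2 * L * (t - t0) = - (2 * L * t0) + 2 * L * t by ring.
have -> : - (- (2 * L * t0) + 2 * L * t) = 2 * L * t0 + - (2 * L) * t by ring.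
by rewrite !expRD /GRing.scale/=; ring.
Qed.

Lemma exp_weight_ge1 t : 1 <= exp_weight t.
Proof.
rewrite /exp_weight; have [h|/ltW h] := leP 0 (2 * L * (t - t0)).
  by rewrite ler_wpDr ?expR_ge0// -[leLHS]expR0 ler_expR.
by rewrite ler_wpDl ?expR_ge0// -[leLHS]expR0 ler_expR oppr_ge0.
Qed.

End ExpWeight.

Section Picard.
Context {R : realType} {V : normedVectType R} {ip : {dot V for idfun}}.
Hypothesis ipE : forall x, ip x x = `|x| ^+ 2.

(** Mean value comparison with A / 2 times [exp_weight_prim], whose derivative is L A times the
    weight. *)
Lemma exp_weight_bound {D dD : R -> V} {L A t0 : R} :
  (forall s, is_derive s (1 : R) D (dD s)) -> D t0 = 0 ->
  (forall s, `|dD s| <= L * (A * exp_weight L t0 s)) ->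
  0 <= A -> forall t, `|D t| <= A / 2 * exp_weight L t0 t.
Proof using ipE.
move=> Dd D0 DA A0 t.
have gd s : is_derive s (1 : R) ((A / 2) \*: exp_weight_prim L t0)
    (L * (A * exp_weight L t0 s)).
  have h : is_derive s (1 : R) ((A / 2) \*: exp_weight_prim L t0)
      ((A / 2) *: (2 * L * exp_weight L t0 s)).
    by apply: is_deriveZ; exact: is_derive_exp_weight_prim.
  apply: (is_derive_eq h).
  by rewrite /GRing.scale/=; field.
have := mean_value_abs_le ipE t0 t Dd gd DA.
rewrite D0 subr0 /= exp_weight_prim0 scaler0 subr0 normrZ => /le_trans -> //.
rewrite ger0_norm ?divr_ge0// ler_wpM2l ?divr_ge0//.
exact: exp_weight_prim_le.
Qed.

(** Picard iteration on the whole line at once: the weight gives each step the factor 1/2 whatever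
    [L] is, so no short time intervals have to be patched. *)
Lemma lipschitz_ode {F : V -> V} {L B : R} (t0 : R) (c0 : V) : 0 < L ->
  (forall x, `|F x| <= B) -> (forall x y, `|F x - F y| <= L * `|x - y|) ->
  exists2 x : R -> V, x t0 = c0 & forall t, is_derive t (1 : R) x (F (x t)).
Proof using ipE.
move=> L0 FB FL; have cF := lipschitz_continuous FL.
have B0 : 0 <= B by exact: le_trans (FB 0).
(* On discontinuous curves [step] takes an arbitrary value; the iterates starting from [cst c0] are
   all continuous. *)
have /choice[step stepP] : forall x : R -> V, exists y : R -> V, continuous x ->
    y t0 = c0 /\ forall t, is_derive t (1 : R) y (F (x t)).
  move=> x; have [cx|ncx] := pselect (continuous x); last by exists x.
  have cFx : continuous (F \o x).
    by move=> t; apply: continuous_comp; [exact: cx|exact: cF].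
  by have [y y0 yd] := curve_primitive ipE t0 c0 cFx; exists y.
pose x n := iter n step (cst c0).
have cx n : continuous (x n).
  elim: n => [|n IH] t; first exact: cvg_cst.
  by have [_ /(_ t)] := stepP _ IH; exact: is_derive_continuous.
have xt0 n : x n t0 = c0.
  by case: n => [//|n]; have [] := stepP _ (cx n).
have xd n t : is_derive t (1 : R) (x n.+1) (F (x n t)).
  by have [_] := stepP _ (cx n).
(* Chosen so that B = L A; since the weight is at least 1, this bounds the first increment. *)
pose A := B / L; have A0 : 0 <= A by rewrite divr_ge0// ltW.
pose w := exp_weight L t0.
have w0 t : 0 <= w t by exact: le_trans (exp_weight_ge1 _ _ _).
have xS n t : `|x n.+1 t - x n t| <= (A * w t) / 2 ^+ n.
  elim: n t => [|n IH] t.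
    rewrite expr0 divr1.
    have dd s : is_derive s (1 : R) (x 1%N - x 0%N) (F c0 - 0).
      by apply: is_deriveB.
    have := exp_weight_bound (L := L) (A := A) (t0 := t0) dd.
    move=> /(_ _ _ A0 t) h; apply: (le_trans (h _ _)).
    - by rewrite !fctE !xt0 subrr.
    - move=> s; rewrite subr0 (le_trans (FB _))// /A mulrA [L * _]mulrC divfK ?gt_eqF//.
      by rewrite ler_peMr// exp_weight_ge1.
    - rewrite ler_wpM2r ?w0//.
      by rewrite ler_pdivrMr// ler_peMr//; lra.
  have dd s : is_derive s (1 : R) (x n.+2 - x n.+1) (F (x n.+1 s) - F (x n s)).
    by apply: is_deriveB; exact: xd.
  have AA : 0 <= A / 2 ^+ n by rewrite divr_ge0// exprn_ge0.
  have := exp_weight_bound (L := L) (A := A / 2 ^+ n) (t0 := t0) dd.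
  move=> /(_ _ _ AA t) h; apply: (le_trans (h _ _)).
  - by rewrite !fctE !xt0 subrr.
  - move=> s; apply: le_trans (FL _ _) (ler_wpM2l (ltW L0) _).
    by rewrite mulrAC; exact: IH.
  - rewrite exprS invfM le_eqVlt; apply/orP; left; apply/eqP.
    by set a := (2 ^+ n)^-1; rewrite /w; field.
have /choice[y xy] := fun t => geometric_cvg ipE (fun n => xS n t).
(* Every iterate after the first is B-Lipschitz by the mean value estimate, and the limit inherits
   this. Hence F o y is continuous and has a primitive [z]. *)
have ylip s t : `|y s - y t| <= B * `|s - t|.
  have gd r : is_derive r (1 : R) (B \*: (id : R -> R)) (B *: 1).
    exact: is_deriveZ.
  rewrite -subr_le0; apply: (le_of_le_geometric (C := 4 * A * (w s + w t))) => n.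
  have h : `|x n.+1 s - x n.+1 t| <= B * `|s - t|.
    rewrite (le_trans (mean_value_abs_le ipE t s (xd n) gd _))//.
      by move=> r; rewrite (le_trans (FB _))// /GRing.scale/= mulr1.
    by rewrite -scalerBr normrZ ger0_norm.
  have -> : y s - y t = (y s - x n.+1 s) + (x n.+1 s - x n.+1 t) + (x n.+1 t - y t).
    by rewrite !addrA !subrK.
  have hs := xy s n.+1; have ht := xy t n.+1; rewrite distrC in hs.
  rewrite lerBlDr (le_trans (ler_normD _ _))//.
  rewrite (le_trans (lerD (le_trans (ler_normD _ _) (lerD hs h)) ht))//.
  rewrite exprS invfM; set a := (2 ^+ n)^-1.
  have a0 : 0 <= a by rewrite invr_ge0 exprn_ge0.
  have ws : 0 <= A * w s * a := mulr_ge0 (mulr_ge0 A0 (w0 s)) a0.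
  have wt : 0 <= A * w t * a := mulr_ge0 (mulr_ge0 A0 (w0 t)) a0.
  rewrite -subr_ge0.
  have -> : 4 * A * (w s + w t) * a + B * `|s - t| - (2 * (A * w s) * (2^-1 * a) +
      B * `|s - t| + 2 * (A * w t) * (2^-1 * a)) = 3 * (A * w s * a) + 3 * (A * w t * a).
    by field.
  by rewrite addr_ge0// mulr_ge0.
have cy := lipschitz_continuous ylip.
have cFy : continuous (F \o y).
  by move=> t; apply: continuous_comp; [exact: cy|exact: cF].
have [z z0 zd] := curve_primitive ipE t0 c0 cFy.
(* Both [z] and [y] lie within a multiple of 2^-n of [x n.+1] at each t: for [z], compare the
   derivatives F(y) and F(x n). *)
suff zy : z = y by exists z => // t; rewrite {2}zy; exact: zd.
apply/funext => t; apply/eqP; rewrite -subr_eq0 -normr_le0.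
apply: (le_of_le_geometric (C := 2 * A * w t)) => n.
have dd s : is_derive s (1 : R) (z - x n.+1) (F (y s) - F (x n s)).
  by apply: is_deriveB.
have AA : 0 <= 2 * A / 2 ^+ n by rewrite divr_ge0 ?exprn_ge0// mulr_ge0.
have := exp_weight_bound (L := L) (A := 2 * A / 2 ^+ n) (t0 := t0) dd.
move=> /(_ _ _ AA t) h.
have {}h : `|z t - x n.+1 t| <= 2 * A / 2 ^+ n / 2 * w t.
  apply: h; first by rewrite !fctE z0 xt0 subrr.
  move=> s; apply: le_trans (FL _ _) (ler_wpM2l (ltW L0) _).
  by rewrite distrC mulrAC -(mulrA 2); exact: xy.
rewrite (le_trans (ler_distD (x n.+1 t) _ _))// (le_trans (lerD h (xy t n.+1)))//.
rewrite exprS invfM le_eqVlt; apply/orP; left; apply/eqP.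
by set a := (2 ^+ n)^-1; field.
Qed.

End Picard.

(** * Global solutions from a priori bounds *)

Definition lipschitz_on_balls {R : realType} {U W : normedModType R}
    (F : U -> W) :=
  forall r : R, exists L : R, forall x y, `|x| <= r -> `|y| <= r ->
    `|F x - F y| <= L * `|x - y|.

Section Cutoff.
Context {R : realType} {U W : normedModType R}.
Variable r : R.

Definition cutoff (x : U) : R := Num.max 0 (Num.min 1 (r + 1 - `|x|)).

Lemma cutoff_ge0 x : 0 <= cutoff x.
Proof. by rewrite le_max lexx. Qed.

Lemma cutoff_le1 x : cutoff x <= 1.
Proof. by rewrite ge_max ler01 ge_min lexx. Qed.

Lemma cutoff1 x : `|x| <= r -> cutoff x = 1.
Proof. by move=> xr; rewrite /cutoff min_l ?max_r//; lra. Qed.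

Lemma cutoff0 x : r + 1 < `|x| -> cutoff x = 0.
Proof. by move=> xr; rewrite /cutoff max_l// ge_min; apply/orP; right; lra. Qed.

Lemma cutoff_lipschitz x y : `|cutoff x - cutoff y| <= `|x - y|.
Proof.
apply: (le_trans _ (ler_dist_dist x y)); rewrite /cutoff.
set a := `|x|; set b := `|y|.
rewrite ler_norml; have := ler_norm (a - b); have := ler_norm (- (a - b)).
rewrite normrN /Num.max /Num.min.
by do 4?case: ifPn; rewrite -?leNgt => *; apply/andP; split; lra.
Qed.

Lemma cutoff_field_bounded {F : U -> W} : lipschitz_on_balls F ->
  exists B : R, forall x, `|cutoff x *: F x| <= B.
Proof.
(* As [r] may be negative, the absolute value keeps 0 in the ball, so that F x can be compared with
   F 0. *)
move=> /(_ `|r + 1|)[L FL]; exists (`|F 0| + `|L| * `|r + 1|) => x.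
rewrite normrZ (ger0_norm (cutoff_ge0 x)).
have [xr|xr] := leP `|x| (r + 1); last first.
  by rewrite cutoff0// mul0r addr_ge0// mulr_ge0.
have xr' : `|x| <= `|r + 1| by rewrite (le_trans xr)// ler_norm.
rewrite (le_trans (ler_piMl _ (cutoff_le1 x)))//.
rewrite -[F x](subrK (F 0)) addrC (le_trans (ler_normD _ _))// lerD2l.
have := FL x 0 xr'; rewrite normr0 subr0 => /(_ (normr_ge0 _))/le_trans; apply.
by rewrite (le_trans (ler_wpM2r _ (ler_norm L)))// ler_wpM2l.
Qed.

(** If x lies in the ball of radius r + 1, the difference splits as (cutoff x - cutoff y) F x +
    cutoff y (F x - F y). Symmetry covers y in the ball, and with both points outside the field
    vanishes. *)
Lemma cutoff_field_lipschitz {F : U -> W} : lipschitz_on_balls F ->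
  exists2 L : R, 0 < L &
    forall x y, `|cutoff x *: F x - cutoff y *: F y| <= L * `|x - y|.
Proof.
move=> Fl; have [B FB] := cutoff_field_bounded Fl.
have [L FL] := Fl (r + 1).
have [M FM] : exists M : R, forall x, `|x| <= r + 1 -> `|F x| <= M.
  exists (`|F 0| + `|L| * `|r + 1|) => x xr.
  rewrite -[F x](subrK (F 0)) addrC (le_trans (ler_normD _ _))// lerD2l.
  have := FL x 0 xr; rewrite normr0 subr0 => /(_ (le_trans (normr_ge0 _) xr)) h.
  rewrite (le_trans h)// (le_trans (ler_wpM2r _ (ler_norm L)))// ler_wpM2l//.
  by rewrite (le_trans xr)// ler_norm.
have ext x y : `|x| <= r + 1 ->
    `|cutoff x *: F x - cutoff y *: F y| <= (`|M| + `|L| + 1) * `|x - y|.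
  move=> xr.
  have -> : cutoff x *: F x - cutoff y *: F y =
      (cutoff x - cutoff y) *: F x + cutoff y *: (F x - F y).
    by rewrite scalerBl scalerBr addrA subrK.
  rewrite (le_trans (ler_normD _ _))// !normrZ -addrA mulrDl.
  rewrite lerD//.
    rewrite mulrC ler_pM//; last exact: cutoff_lipschitz.
    by rewrite (le_trans (FM _ xr))// ler_norm.
  have [yr|yr] := leP `|y| (r + 1); last first.
    by rewrite cutoff0// normr0 mul0r mulr_ge0// addr_ge0.
  rewrite (ger0_norm (cutoff_ge0 y)) (le_trans (ler_piMl _ (cutoff_le1 y)))//.
  rewrite (le_trans (FL _ _ xr yr))// ler_wpM2r//.
  by rewrite (le_trans (ler_norm _))// lerDl.
exists (`|M| + `|L| + 1) => [|x y]; first by rewrite ltr_wpDl// addr_ge0.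
have [xr|xr] := leP `|x| (r + 1); first exact: ext.
have [yr|yr] := leP `|y| (r + 1).
  by rewrite distrC (distrC x); exact: ext.
by rewrite !cutoff0// !scale0r subrr normr0 mulr_ge0// !addr_ge0.
Qed.

End Cutoff.

Section GlobalODE.
Context {R : realType} {V : normedVectType R} {ip : {dot V for idfun}}.
Hypothesis ipE : forall x, ip x x = `|x| ^+ 2.
Variable F : V -> V.
Hypothesis F_lip : lipschitz_on_balls F.

Lemma curve_bounded {x dx : R -> V} {a b : R} :
  (forall s, a <= s <= b -> is_derive s (1 : R) x (dx s)) ->
  exists r : R, forall s, a <= s <= b -> `|x s| <= r.
Proof.
move=> xd; have [ab|ba] := leP a b; last first.
  by exists 0 => s /andP[/le_trans h /h]; rewrite leNgt ba.
have cx : {within `[a, b], continuous (fun s => `|x s|)}.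
  move=> s; apply: continuous_comp; last exact: norm_continuous.
  exact: (is_derive_within_continuous _ _ _ _ xd).
have [c _ cM] := EVT_max ab cx.
by exists `|x c| => s sab; apply: cM; rewrite in_itv.
Qed.

(** On a compact segment both curves stay in one ball, where [F] is Lipschitz, so their difference
    satisfies a linear bound and vanishes. *)
Lemma ode_unique {x y : R -> V} {a b t0 : R} : a <= t0 <= b ->
  (forall s, a <= s <= b -> is_derive s (1 : R) x (F (x s))) ->
  (forall s, a <= s <= b -> is_derive s (1 : R) y (F (y s))) ->
  x t0 = y t0 -> forall t, a <= t <= b -> x t = y t.
Proof using ipE F_lip.
move=> t0ab xd yd xy0 t tab.
have [rx xr] := curve_bounded xd; have [ry yr] := curve_bounded yd.
have [L FL] := F_lip (Num.max rx ry).
apply/eqP; rewrite -subr_eq0; apply/eqP.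
apply: (@curve_eq0 _ _ _ ipE (x - y) (fun s => F (x s) - F (y s)) L a b t0) => //.
- by move=> s sab; have ? := xd _ sab; have ? := yd _ sab; exact: is_deriveB.
- move=> s sab; apply: FL; rewrite le_max; first by rewrite xr.
  by rewrite yr ?orbT.
- by rewrite !fctE xy0 subrr.
Qed.

(* The bound required by the hypothesis covers all slowed-down flows, because
   a cut-off field is the original one up to a factor in [0, 1]; this makes the
   cut-off invisible without an exit-time argument. *)
Lemma global_ode (t0 : R) (c0 : V) :
  (forall T : R, exists r : R, forall (g : R -> R) (x : R -> V),
     (forall t, 0 <= g t <= 1) -> x t0 = c0 ->
     (forall t, is_derive t (1 : R) x (g t *: F (x t))) ->
     forall t, `|t - t0| <= T -> `|x t| <= r) ->
  exists2 x : R -> V, x t0 = c0 & forall t, is_derive t (1 : R) x (F (x t)).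
Proof using ipE F_lip.
move=> apriori.
have /choice[x xP] : forall n : nat, exists x : R -> V, x t0 = c0 /\
    forall t, `|t - t0| <= n%:R -> is_derive t (1 : R) x (F (x t)).
  move=> n; have [r rP] := apriori n%:R.
  have [B FB] := cutoff_field_bounded r F_lip.
  have [L L0 FL] := cutoff_field_lipschitz r F_lip.
  have [x x0 xd] := lipschitz_ode ipE t0 c0 L0 FB FL.
  exists x; split=> // t tn.
  have xr := rP (fun t => cutoff r (x t)) x _ x0 xd t tn.
  have := xd t; rewrite cutoff1 ?scale1r//; apply: xr => s.
  by rewrite cutoff_ge0 cutoff_le1.
have xd n t : `|t - t0| < n%:R -> is_derive t (1 : R) (x n) (F (x n t)).
  by move=> /ltW; have [_] := xP n; exact.
have xx n m t : (n <= m)%N -> `|t - t0| < n%:R -> x n t = x m t.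
  move=> nm tn.
  (* The closed segment of radius |t - t0| around [t0] lies inside the domains of both curves. *)
  apply: (@ode_unique (x n) (x m) (t0 - `|t - t0|) (t0 + `|t - t0|) t0).
  - by have := normr_ge0 (t - t0); lra.
  - move=> s sb; apply: xd; apply: le_lt_trans tn; by rewrite ler_distl.
  - move=> s sb; apply: xd; apply: (@lt_le_trans _ _ n%:R); last by rewrite ler_nat.
    by apply: le_lt_trans tn; rewrite ler_distl.
  - by have [-> _] := xP n; have [-> _] := xP m.
  - by rewrite -ler_distl.
have [y yt0 yd] := glue_curves (fun=> F) t0 x xd xx.
by exists y => //; rewrite yt0; have [] := xP 1%N.
Qed.

End GlobalODE.

(** * The flow of a cochain algebra *)

(** Duality: take b = z. *)
Lemma norm_le_of_dot {R : realType} {V : normedVectType R}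
    {ip : {dot V for idfun}} (ipE : forall x, ip x x = `|x| ^+ 2) (z : V) (K : R) :
  0 <= K -> (forall b, `|ip z b| <= K * `|b|) -> `|z| <= K.
Proof.
move=> K0 zK; have [->|z0] := eqVneq z 0; first by rewrite normr0.
have nz : 0 < `|z| by rewrite normr_gt0.
by rewrite -(ler_pM2r nz) -expr2 -ipE (le_trans (ler_norm _))// zK.
Qed.

(** For p the projection of z, |p|^2 = <z,p> <= |z| |p|. *)
Lemma orthoproj_norm_le {R : realType} {V : normedVectType R}
    {ip : {dot V for idfun}} (ipE : forall x, ip x x = `|x| ^+ 2)
    (U : {vspace V}) (z : V) : `|orthoproj ip U z| <= `|z|.
Proof.
have [->|p0] := eqVneq (orthoproj ip U z) 0; first by rewrite normr0.
have np : 0 < `|orthoproj ip U z| by rewrite normr_gt0.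
rewrite -(ler_pM2r np) -expr2 -ipE orthoprojP ?orthoproj_in//.
by rewrite (le_trans (ler_norm _))// dot_le_norm.
Qed.

Section FlowOfCochainAlgebra.
Context {R : realType}.
Variables (C : cochainAlgebra R) (nu : R).

Lemma cup_self0 (c : C 1%N) : cup C 1 1 c c = 0.
Proof.
(* The cast runs along a proof of 1 + 1 = 1 + 1, hence is the identity, and the sign in degree (1,1)
   is -1. *)
have := cupC c c; rewrite (eq_axiomK (addnC 1 1)) /= expr1 scaleN1r => h.
apply/eqP; move/eqP: h.
by rewrite -addr_eq0 -mulr2n -scaler_nat scaler_eq0 pnatr_eq0.
Qed.

Lemma dot_flow (c u : C 1%N) : cobdry_adj C 0 u = 0 ->
  inner C 1 (coclosed_proj C (Tnu nu c)) u =
    inner C 2 (cobdry C 1 c) (cup C 1 1 c u)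
    - nu * inner C 2 (cobdry C 1 c) (cobdry C 1 u).
Proof. by move=> u0; rewrite orthoprojP ?TnuP// memv_ker u0. Qed.

Lemma flow_coclosed (c : C 1%N) : cobdry_adj C 0 (coclosed_proj C c) = 0.
Proof. by apply/eqP; rewrite -memv_ker orthoproj_in. Qed.

Lemma harmonic_steady (c : C 1%N) :
  cobdry C 1 c = 0 -> coclosed_proj C (Tnu nu c) = 0.
Proof.
move=> c0; suff -> : Tnu nu c = 0 by rewrite linear0.
apply: (@dot_inj _ _ (inner C 1)) => b.
by rewrite TnuP c0 !linear0l mulr0 subrr.
Qed.

Lemma coclosed_energy (J : set R) (c : R -> C 1%N) :
  flow_solution nu J c -> (forall t, J t -> cobdry_adj C 0 (c t) = 0) ->
  forall t, J t -> is_derive t (1 : R) (fun s => `|c s| ^+ 2)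
    (- (2 * nu * `|cobdry C 1 (c t)| ^+ 2)).
Proof.
move=> cs c0 t Jt; have E1 := innerE (c := C) (j := 1).
apply: (is_derive_eq (is_derive_sqr_norm E1 _ _ _ (cs t Jt))).
by rewrite dot_flow ?c0// cup_self0 linear0r (innerE (cobdry C 1 (c t))); ring.
Qed.

(* With d^* the adjoint of d, d^* d h is co-closed and |d h|^2 = <h, d^* d h>. *)
Lemma closed_of_orthogonal_coclosed (h : C 1%N) :
  (forall v, cobdry_adj C 0 v = 0 -> inner C 1 h v = 0) -> cobdry C 1 h = 0.
Proof.
move=> hv; apply/eqP; rewrite -normr_eq0 -sqrf_eq0 -innerE.
rewrite -(adjointP (inner C 1)) (dot_sym (inner C 1)) hv//.
apply: (@dot_inj _ _ (inner C 0)) => b.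
by rewrite adjointP adjointP cobdryK linear0r linear0l.
Qed.

Lemma cobdry_cup_bounded : exists M K : R, [/\ 0 <= M, 0 <= K,
  forall a : C 1%N, `|cobdry C 1 a| <= M * `|a| &
  forall a b : C 1%N, `|cup C 1 1 a b| <= K * `|a| * `|b|].
Proof.
have E1 := innerE (c := C) (j := 1).
have [M M0 MP] := linear_bounded E1 (cobdry C 1).
have [K K0 KP] := bilinear_bounded E1 E1 (cup C 1 1).
by exists M, K.
Qed.

Hypothesis nu_ge0 : 0 <= nu.

Lemma flow_lipschitz_on_balls :
  lipschitz_on_balls (fun c : C 1%N => coclosed_proj C (Tnu nu c)).
Proof using nu_ge0.
have [M [K [M0 K0 MP KP]]] := cobdry_cup_bounded.
have E1 := innerE (c := C) (j := 1); have E2 := innerE (c := C) (j := 2).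
(* M bounds the coboundary and K the product: each of the two quadratic terms below contributes M K
   |r|, the viscous term nu M^2. *)
move=> r; exists (2 * M * K * `|r| + nu * M ^+ 2) => x y xr yr.
rewrite -linearB (le_trans (orthoproj_norm_le E1 _ _))//.
have L0 : 0 <= 2 * M * K * `|r| + nu * M ^+ 2.
  by rewrite addr_ge0 ?mulr_ge0 ?exprn_ge0.
apply: (norm_le_of_dot E1) => [|b]; first by rewrite mulr_ge0.
(* The quadratic part is differenced one factor at a time: first in the coboundary, then in the
   product. *)
have -> : inner C 1 (Tnu nu x - Tnu nu y) b =
    inner C 2 (cobdry C 1 (x - y)) (cup C 1 1 x b)
    + inner C 2 (cobdry C 1 y) (cup C 1 1 (x - y) b)
    - nu * inner C 2 (cobdry C 1 (x - y)) (cobdry C 1 b).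
  rewrite linearBl/= !TnuP (linearB (cobdry C 1))/= !linearBl/= linearBr/=; ring.
have xr' := le_trans xr (ler_norm r); have yr' := le_trans yr (ler_norm r).
set d := `|x - y|.
have h1 : `|inner C 2 (cobdry C 1 (x - y)) (cup C 1 1 x b)| <= M * K * `|r| * d * `|b|.
  rewrite (le_trans (dot_le_norm E2 _ _))//.
  rewrite (le_trans (ler_pM _ _ (MP _) (KP _ _)))//.
  have -> : M * K * `|r| * d * `|b| = M * d * (K * `|r| * `|b|) by ring.
  by rewrite ler_wpM2l ?mulr_ge0// ler_wpM2r// ler_wpM2l.
have h2 : `|inner C 2 (cobdry C 1 y) (cup C 1 1 (x - y) b)| <= M * K * `|r| * d * `|b|.
  rewrite (le_trans (dot_le_norm E2 _ _))//.
  rewrite (le_trans (ler_pM _ _ (MP _) (KP _ _)))//.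
  have -> : M * K * `|r| * d * `|b| = M * `|r| * (K * d * `|b|) by ring.
  by rewrite ler_wpM2r ?mulr_ge0// ler_wpM2l.
have h3 : `|nu * inner C 2 (cobdry C 1 (x - y)) (cobdry C 1 b)| <= nu * M ^+ 2 * d * `|b|.
  rewrite normrM ger0_norm// -!mulrA ler_wpM2l//.
  rewrite (le_trans (dot_le_norm E2 _ _))//.
  rewrite (le_trans (ler_pM _ _ (MP _) (MP _)))// -/d.
  by rewrite le_eqVlt; apply/orP; left; apply/eqP; ring.
rewrite (le_trans (ler_normB _ _))//.
rewrite (le_trans (lerD (le_trans (ler_normD _ _) (lerD h1 h2)) h3))//.
by rewrite le_eqVlt; apply/orP; left; apply/eqP; ring.
Qed.

(* Splitting x = u + h with u co-closed and h constant and closed, the cubic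
   term of the energy balance of u becomes <cobdry u, h cup u>, since u cup u = 0. *)
Lemma flow_apriori (t0 : R) (c0 : C 1%N) (T : R) :
  exists r : R, forall (g : R -> R) (x : R -> C 1%N),
    (forall t, 0 <= g t <= 1) -> x t0 = c0 ->
    (forall t, is_derive t (1 : R) x (g t *: coclosed_proj C (Tnu nu (x t)))) ->
    forall t, `|t - t0| <= T -> `|x t| <= r.
Proof using nu_ge0.
have [M [K [M0 K0 MP KP]]] := cobdry_cup_bounded.
have E0 := innerE (c := C) (j := 0).
have E1 := innerE (c := C) (j := 1); have E2 := innerE (c := C) (j := 2).
pose h := c0 - coclosed_proj C c0.
have dh : cobdry C 1 h = 0.
  apply: closed_of_orthogonal_coclosed => v v0.
  by rewrite linearBl/= orthoprojP ?subrr// memv_ker v0.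
(* The Gronwall constant of |u|^2: M K |h| bounds the term with h cup u, nu M^2 the viscous one, and
   2 comes from differentiating the square. *)
pose k := 2 * (M * K * `|h| + nu * M ^+ 2).
have k0 : 0 <= k by rewrite !(mulr_ge0, addr_ge0, exprn_ge0).
(* The bound |u| <= 1 + |u|^2 avoids a square root. *)
exists (`|h| + (1 + `|c0 - h| ^+ 2 * expR (k * T))) => g x g01 x0 xd t tT.
pose u s := x s - h.
(* The slowed velocity is still co-closed, so the adjoint coboundary of u has zero derivative; it
   vanishes at [t0], where u is the projection of [c0]. *)
have u0 s : cobdry_adj C 0 (u s) = 0.
  apply: (@curve_eq0 _ _ _ E0 (fun s => cobdry_adj C 0 (u s)) (fun=> 0) 0
      (t0 - `|s - t0|) (t0 + `|s - t0|) t0).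
  - by have := normr_ge0 (s - t0); lra.
  - move=> r _.
    have := is_derive_linear E1 (cobdry_adj C 0) _ _ _
      (is_deriveB (xd r) (is_derive_cst h r (1 : R))).
    by rewrite subr0 linearZ/= flow_coclosed scaler0.
  - by move=> r _; rewrite normr0 mul0r.
  - by rewrite /u x0 subKr flow_coclosed.
  - by rewrite -ler_distl.
have Ed s : is_derive s (1 : R) (fun s => `|u s| ^+ 2)
    (2 * inner C 1 (g s *: coclosed_proj C (Tnu nu (x s))) (u s)).
  apply: (is_derive_sqr_norm E1).
  by have := is_deriveB (xd s) (is_derive_cst h s (1 : R)); rewrite subr0.
have EK s : `|2 * inner C 1 (g s *: coclosed_proj C (Tnu nu (x s))) (u s)|
    <= k * `|u s| ^+ 2.
  have /andP[g0 g1] := g01 s.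
  rewrite linearZl/= dot_flow// normrM ger0_norm// /k -mulrA ler_wpM2l//.
  rewrite normrM (ger0_norm g0) (le_trans (ler_piMl _ g1))//.
  have xu : x s = u s + h by rewrite /u subrK.
  have -> : cobdry C 1 (x s) = cobdry C 1 (u s) by rewrite xu linearD/= dh addr0.
  have -> : cup C 1 1 (x s) (u s) = cup C 1 1 h (u s).
    by rewrite xu linearDl/= cup_self0 add0r.
  rewrite (innerE (cobdry C 1 (u s))) (le_trans (ler_normB _ _))// mulrDl.
  apply: lerD.
    rewrite (le_trans (dot_le_norm E2 _ _))//.
    rewrite (le_trans (ler_pM _ _ (MP _) (KP _ _)))//.
    by rewrite le_eqVlt; apply/orP; left; apply/eqP; ring.
  rewrite ger0_norm ?mulr_ge0 ?sqr_ge0// -mulrA ler_wpM2l// -exprMn.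
  by rewrite ler_pXn2r// nnegrE// mulr_ge0.
have ut : `|u t| ^+ 2 <= `|c0 - h| ^+ 2 * expR (k * T).
  have eT : expR (k * `|t - t0|) <= expR (k * T) by rewrite ler_expR ler_wpM2l.
  rewrite -x0 -/(u t0) (le_trans _ (ler_wpM2l _ eT))//.
  have [tt|/ltW tt] := leP t0 t.
    have [+ _] := gronwall tt (fun s _ => Ed s) (fun s _ => EK s).
    by rewrite (@ger0_norm _ (t - t0))// subr_ge0.
  have [_ +] := gronwall tt (fun s _ => Ed s) (fun s _ => EK s).
  by rewrite (distrC t) (@ger0_norm _ (t0 - t))// subr_ge0.
have -> : x t = h + u t by rewrite /u addrC subrK.
rewrite (le_trans (ler_normD _ _))// lerD2l (le_trans _ (lerD (lexx 1) ut))//.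
have := sqr_ge0 (`|u t| - 1); have := normr_ge0 (u t).
set a := `|u t|; nra.
Qed.

Lemma flow_global (t0 : R) (c0 : C 1%N) :
  exists2 c : R -> C 1%N, c t0 = c0 /\ flow_solution nu setT c &
    forall (J : set R) (c' : R -> C 1%N), is_interval J -> J t0 ->
      flow_solution nu J c' -> c' t0 = c0 -> forall t, J t -> c' t = c t.
Proof using nu_ge0.
have E1 := innerE (c := C) (j := 1).
have Fl := flow_lipschitz_on_balls.
have [c ct0 cd] := global_ode E1 _ Fl t0 c0 (flow_apriori t0 c0).
exists c => [|J c' iJ Jt0 c'd c't0 t Jt]; first by split=> // t _; exact: cd.
(* The segment between [t0] and t, in either order, lies in J by convexity, so uniqueness can be
   applied on it. *)
have sJ (s : R) : Num.min t0 t <= s <= Num.max t0 t -> J s.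
  rewrite /Num.min /Num.max; case: ifPn => _ st; first exact: iJ Jt0 Jt _ st.
  exact: iJ Jt Jt0 _ st.
apply: (ode_unique E1 _ Fl (a := Num.min t0 t) (b := Num.max t0 t) (t0 := t0)).
- by rewrite ge_min le_max !lexx.
- by move=> s /sJ; exact: c'd.
- by rewrite c't0 ct0.
- by rewrite ge_min le_max !lexx !orbT.
Qed.

End FlowOfCochainAlgebra.

Theorem mainTheorem3 (R : realType) (C : cochainAlgebra R) (nu : R)
    (nu_ge0 : 0 <= nu) :
  [/\ (* (i) harmonic elements are steady states *)
      forall c : C 1%N, cobdry C 1 c = 0 -> cobdry_adj C 0 c = 0 ->
        coclosed_proj C (Tnu nu c) = 0,
      (* (ii) energy identity for co-closed solutions *)
      forall (J : set R) (c : R -> C 1%N),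
        open J -> is_interval J -> flow_solution nu J c ->
        (forall t, J t -> cobdry_adj C 0 (c t) = 0) ->
        forall t, J t ->
          is_derive t (1 : R) (fun s => `|c s| ^+ 2)
            (- (2 * nu * `|cobdry C 1 (c t)| ^+ 2)) &
      (* (iii) the solution through any initial value exists for all time, and
         every solution on an open interval is a restriction of it *)
      forall (t0 : R) (c0 : C 1%N),
        exists2 c : R -> C 1%N, c t0 = c0 /\ flow_solution nu setT c &
          forall (J : set R) (c' : R -> C 1%N),
            open J -> is_interval J -> J t0 ->
            flow_solution nu J c' -> c' t0 = c0 ->
            forall t, J t -> c' t = c t].
Proof.
split=> [c c0 _|J c _ _|t0 c0]; [exact: harmonic_steady|exact: coclosed_energy|].
have [c cP cU] := flow_global C nu nu_ge0 t0 c0.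
by exists c => // J c' _; exact: cU.
Qed.
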